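(* For each $1 \le k \le n$, the map $f_n$ is a bijection from $Bl_{n,k}$ onto $L_{n,n-k}$ which preserves the set of left-to-right maxima, i.e., $\mathrm{Ltr}(f_n(\pi))=\mathrm{Ltr}(\pi)$.
   Context: $\S_n(321)$ is the set of $321$-avoiding permutations in $\S_n$. $\mathrm{Ltr}(\pi)=\{i:\pi(i)=\max\{\pi(1),\dots,\pi(i)\}\}$; $\mathrm{ldes}(\pi)$ is the largest $i$ with $\pi(i)>\pi(i+1)$ ($0$ if none); $\mathrm{bl}(\pi)=|\{i : \pi(j)\le i \text{ for all } j\le i\}|$ is the block number. $Bl_{n,k}=\{\pi\in\S_n(321):\mathrm{bl}(\pi)=k\}$ and $L_{n,k}=\{\pi\in\S_n(321):\mathrm{ldes}(\pi^{-1})=k\}$. Maps $f_n:\S_n(321)\to\S_n(321)$ are defined recursively: $f_1$ is the identity on $\S_1$. For $\pi\in\S_n(321)$, $n\ge2$, let $k=\mathrm{bl}(\pi)$. Case A: $\pi^{-1}(n)=n$: delete $n$, apply $f_{n-1}$, and insert $n$ at the last position. Case B: $\pi^{-1}(n-1)<\pi^{-1}(n)<n$: delete $n$, apply $f_{n-1}$, insert $n$ at the same position as in $\pi$, and multiply on the left by the transposition $(n-k-1,n-k)$. Case C: $\pi^{-1}(n)<\pi^{-1}(n-1)$ (so $n-1$ is the last letter): let $\pi'=(n-1,n)\pi$, compute $f_n(\pi')$ as in case A, and multiply it on the left by the cycle $(n-k,n-k+1,\dots,n)$. (Left multiplication by a permutation acts on the values/letters.) *)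

(* Defs.v *)
From mathcomp Require Import all_boot all_fingroup.

Set Implicit Arguments.
Unset Strict Implicit.
Unset Printing Implicit Defensive.

(* Permutations of {1, ..., n} are elements of 'S_n, with position (or letter) *)
(* i represented by the ordinal of value i - 1.                                *)

Definition S321 n : {set 'S_n} :=
  [set p : 'S_n | [forall i : 'I_n, forall j : 'I_n, forall l : 'I_n,
     (i < j < l) ==> ~~ (p l < p j < p i)]].

Definition Ltr n (p : 'S_n) : {set 'I_n} :=
  [set i | p i == \max_(j < n | j <= i) p j :> nat].

(* The value is a 1-based position, hence the i.+1; it is 0 for the identity. *)
Definition ldes n (p : 'S_n) : nat :=
  \max_(i < n | [exists j : 'I_n, (j == i.+1 :> nat) && (p j < p i)]) i.+1.

Definition bl n (p : 'S_n) : nat :=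
  #|[set i : 'I_n | [forall j : 'I_n, (j <= i) ==> (p j <= i)]]|.

Definition Bl n k : {set 'S_n} := [set p in S321 n | bl p == k].

Definition L n k : {set 'S_n} := [set p in S321 n | ldes p^-1%g == k].

(* (lmulp c p) i = c (p i): MathComp composes permutations left to right.      *)
Definition lmulp n (c p : 'S_n) : 'S_n := (p * c)%g.

(* The letter v, counted from 1, in {1, ..., m.+1}.                            *)
Definition letter m (v : nat) : 'I_m.+1 := inord v.-1.

(* Position of the largest letter.                                             *)
Definition pos_max m (p : 'S_m.+1) : 'I_m.+1 := p^-1%g ord_max.

Definition del_max_fun m (p : 'S_m.+1) (i : 'I_m) : 'I_m :=
  odflt i (unlift ord_max (p (lift (pos_max p) i))).

Lemma lift_del_max_fun m (p : 'S_m.+1) (i : 'I_m) :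
  lift ord_max (del_max_fun p i) = p (lift (pos_max p) i).
Proof.
rewrite /del_max_fun; case: unliftP => [j -> //|] /(canRL (permK p)) E.
by have := neq_lift (pos_max p) i; rewrite E eqxx.
Qed.

Lemma del_max_inj m (p : 'S_m.+1) : injective (del_max_fun p).
Proof.
move=> i j E; apply: (@lift_inj _ (pos_max p)); apply: (@perm_inj _ p).
by rewrite -!lift_del_max_fun E.
Qed.

(* Deletion of the largest letter from a word.                                 *)
Definition del_max m (p : 'S_m.+1) : 'S_m := perm (@del_max_inj m p).

(* Insertion of a new largest letter at position i.                            *)
Definition ins_max m (i : 'I_m.+1) (p : 'S_m) : 'S_m.+1 :=
  lift_perm i ord_max p.

Lemma del_maxK m (p : 'S_m.+1) : ins_max (pos_max p) (del_max p) = p.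
Proof.
apply/permP => i; case: (unliftP (pos_max p) i) => [j|] ->.
  by rewrite lift_perm_lift permE lift_del_max_fun.
by rewrite lift_perm_id permKV.
Qed.

(* The cycle (v, v+1, ..., m.+1) on letters counted from 1.                    *)
Definition up_cycle m (v : nat) : 'S_m.+1 := lift_perm ord_max (letter m v) 1%g.

Lemma up_cycleE m v (x : 'I_m.+1) : 0 < v <= m.+1 ->
  (up_cycle m v x).+1 =
    if x.+1 < v then x.+1 else if x.+1 == m.+1 then v else x.+2.
Proof.
case: v => // v /= lv; have lE : letter m v.+1 = v :> nat by rewrite inordK.
rewrite /up_cycle; case: (unliftP ord_max x) => [j|] ->.
  rewrite lift_perm_lift perm1 lift_max /= lE /bump !ltnS eqSS.
  by rewrite (ltn_eqF (ltn_ord j)) leqNgt; case: ltnP.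
by rewrite lift_perm_id lE /= !ltnS eqxx ltnNge -ltnS lv.
Qed.

(* One step of the recursion, from g = f_(n-1) to f_n. Outside S321 the value  *)
(* is meaningless, and the recursion never leaves S321 when started in it.     *)
Definition f_step m : ('S_m -> 'S_m) -> 'S_m.+1 -> 'S_m.+1 :=
  match m with
  | 0 => fun _ p => p
  | m'.+1 => fun g p =>
      let n := m'.+2 in
      let k := bl p in
      let caseA q := ins_max ord_max (g (del_max q)) in
      if p^-1%g (letter _ n) == letter _ n then caseA p
      else if p^-1%g (letter _ n.-1) < p^-1%g (letter _ n) then
        lmulp (tperm (letter _ (n - k - 1)) (letter _ (n - k)))
              (ins_max (pos_max p) (g (del_max p)))
      else
        lmulp (up_cycle _ (n - k))
              (caseA (lmulp (tperm (letter _ n.-1) (letter _ n)) p))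
  end.

Fixpoint f n : 'S_n -> 'S_n :=
  match n with
  | 0 => id
  | m.+1 => f_step (@f m)
  end.

(* Main.v *)
(* By induction, f sends 321-avoiders to 321-avoiders, keeps Ltr and satisfies
   ldes (f p)^-1 = n - bl p: deleting n (in case C, its image under (n-1, n))
   leaves k = bl p unchanged in cases B and C and lowers it by one in case A,
   while in a word with ldes of the inverse equal to d, inserting n behind all
   the left-to-right maxima changes nothing, and both (d, d+1) and the cycle
   (d+1, ..., n) raise d by one.  Injectivity: k is read off the image; case A
   is recognised by n being in Ltr, and in the image the letter d precedes d+2
   in case B but follows it (or d = 0) in case C.  Since f is thus a permutation
   of the finite set S321 carrying bl to n - ldes of the inverse, it maps Bl
   onto L. *)
Require Import Defs.
From mathcomp Require Import all_boot all_fingroup.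
From mathcomp Require Import zify.

Set Implicit Arguments.
Unset Strict Implicit.
Unset Printing Implicit Defensive.

(** * Working forms of avoidance, maxima and the last descent of the inverse *)

Lemma S321P n (p : 'S_n) :
  reflect (forall i j l : 'I_n, i < j -> j < l -> p l < p j -> p j < p i -> False)
          (p \in S321 n).
Proof.
rewrite inE; apply: (iffP forallP) => [av i j l ij jl lj ji | av i].
  by have /forallP/(_ j)/forallP/(_ l) := av i; rewrite ij jl lj ji.
apply/forallP=> j; apply/forallP=> l; apply/implyP=> /andP[ij jl].
by apply/negP=> /andP[lj ji]; apply: (av i j l).
Qed.

Lemma LtrP n (p : 'S_n) (i : 'I_n) :
  reflect (forall j : 'I_n, j < i -> p j < p i) (i \in Ltr p).
Proof.
rewrite inE eqn_leq (@leq_bigmax_cond 'I_n (fun j => j <= i) (fun j => p j) i) //=.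
apply: (iffP (@bigmax_leqP 'I_n (fun j => j <= i) (p i) (fun j => p j))) => H j ji; last first.
  by move: ji; rewrite leq_eqVlt => /orP[/eqP/val_inj->//|/H/ltnW].
have /= := H j (ltnW ji); rewrite leq_eqVlt => /orP[/eqP/val_inj/perm_inj ij|//].
by rewrite ij ltnn in ji.
Qed.

(* [inv_ldes s d] says that [d] is [ldes s^-1], read off the positions of the
   letters: those counted from 1 as d+1, ..., n occur in increasing order, and
   d+1 occurs before d. *)
Definition inv_ldes n (s : 'S_n) (d : nat) : Prop :=
  [/\ forall i j : 'I_n, d <= s i -> s i < s j -> i < j,
      forall i j : 'I_n, (s i).+1 = d -> s j = d :> nat -> j < i
    & d = 0 \/ d < n].

Lemma inv_ldesE n (s : 'S_n) d : inv_ldes s d -> ldes s^-1%g = d.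
Proof.
move=> [inc dec dn]; apply/eqP; rewrite eqn_leq; apply/andP; split.
  apply/bigmax_leqP=> i /existsP[j /andP[/eqP ji lt]].
  have := inc (s^-1%g i) (s^-1%g j); rewrite !permKV; lia.
case: dn => [->//|dn]; case: d dn inc dec => // d dn inc dec.
pose i := Ordinal (ltnW dn); pose j := Ordinal dn.
apply: (@leq_bigmax_cond _ _ (fun i : 'I_n => i.+1) i).
by apply/existsP; exists j; rewrite eqxx dec ?permKV.
Qed.

(** * Inserting a new largest letter *)

Section InsMax.
Variables (m : nat) (i : 'I_m.+1).
Implicit Types (g q : 'S_m).

Lemma ins_max_id g : ins_max i g i = ord_max.
Proof. exact: lift_perm_id. Qed.

Lemma ins_max_lift g y : ins_max i g (lift i y) = g y :> nat.
Proof. by rewrite /ins_max lift_perm_lift lift_max. Qed.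

Lemma lift_lt (y z : 'I_m) : (lift i y < lift i z) = (y < z).
Proof. rewrite /= /bump; lia. Qed.

Lemma lift_lt_id (y : 'I_m) : (lift i y < i) = (y < i).
Proof. rewrite /= /bump; lia. Qed.

Lemma id_lt_lift (y : 'I_m) : (i < lift i y) = (i <= y).
Proof. rewrite /= /bump; lia. Qed.

Lemma S321_ins_max g : ins_max i g \in S321 m.+1 -> g \in S321 m.
Proof.
move=> /S321P av; apply/S321P=> x y z xy yz.
by have := av (lift i x) (lift i y) (lift i z); rewrite !lift_lt !ins_max_lift; apply.
Qed.

Lemma Ltr_ins_max_id g : i \in Ltr (ins_max i g).
Proof.
apply/LtrP=> x; case: (unliftP i x) => [y|] -> lt; last by rewrite ltnn in lt.
by rewrite ins_max_id ins_max_lift ltn_ord.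
Qed.

Lemma Ltr_ins_max_lift g y :
  (lift i y \in Ltr (ins_max i g)) = (y < i) && (y \in Ltr g).
Proof.
apply/LtrP/andP=> [lr | [yi /LtrP lr] x].
  split; last first.
    by apply/LtrP=> z zy; have := lr (lift i z); rewrite lift_lt !ins_max_lift; apply.
  rewrite ltnNge -id_lt_lift; apply/negP => /lr.
  by rewrite ins_max_id ins_max_lift /=; have := ltn_ord (g y); lia.
case: (unliftP i x) => [z|] ->; first by rewrite lift_lt !ins_max_lift; apply: lr.
by rewrite id_lt_lift leqNgt yi.
Qed.

Lemma eq_Ltr_ins_max g q : Ltr g = Ltr q -> Ltr (ins_max i g) = Ltr (ins_max i q).
Proof.
move=> E; apply/setP=> x; case: (unliftP i x) => [y|] ->.
  by rewrite !Ltr_ins_max_lift E.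
by rewrite !Ltr_ins_max_id.
Qed.

Variable g : 'S_m.
Hypothesis nLtr : forall y : 'I_m, i <= y -> y \notin Ltr g.

(* The letters that are not left-to-right maxima of a 321-avoiding word
   increase, so a new maximum may be put in front of them. *)
Lemma ins_max_S321 : g \in S321 m -> ins_max i g \in S321 m.+1.
Proof.
move=> /S321P av; apply/S321P=> a b c.
case: (unliftP i b) => [y|] -> ; last first.
  by rewrite !ins_max_id /= => _ _ _; have := ltn_ord (ins_max i g a); lia.
case: (unliftP i c) => [z|] ->; last first.
  by rewrite !ins_max_id ins_max_lift /=; have := ltn_ord (g y); lia.
case: (unliftP i a) => [x|] ->.
  by rewrite !lift_lt !ins_max_lift; apply: av.
rewrite id_lt_lift lift_lt !ins_max_lift => iy yz zy _.
have /negP := nLtr iy; apply; apply/LtrP => x xy.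
rewrite ltnNge; apply/negP => yx; apply: (av x y z) => //.
rewrite ltn_neqAle yx andbT; apply/eqP => /val_inj /perm_inj E.
by rewrite E ltnn in xy.
Qed.

(** The old largest letter is a left-to-right maximum, so it stands in front of [i]. The letters
    from d+1 on increase up to it, so the new letter comes after all of them. *)
Lemma ins_max_inv_ldes d : inv_ldes g d -> inv_ldes (ins_max i g) d.
Proof.
move=> [inc dec dm]; split; last by lia.
- move=> a b; case: (unliftP i a) => [x|] ->; last first.
    by rewrite ins_max_id /=; have := ltn_ord (ins_max i g b); lia.
  case: (unliftP i b) => [y|] ->.
    by rewrite !ins_max_lift lift_lt; apply: inc.
  rewrite ins_max_lift lift_lt_id => dx _; rewrite ltnNge; apply/negP => ix.
  case: m i g nLtr inc dec dm x dx ix => [|m'] i' g' nL inc _ _ x; first by case: x.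
  move=> dx ix; pose z := (g'^-1)%g ord_max.
  have gz : g' z = ord_max by rewrite permKV.
  have zi : z < i'.
    rewrite ltnNge; apply/negP => /nL /negP; apply; apply/LtrP => j jz.
    rewrite gz ltn_neqAle -ltnS ltn_ord andbT; apply/eqP => E.
    have/perm_inj jE: g' j = g' z by apply/val_inj; rewrite gz; exact: E.
    by rewrite jE ltnn in jz.
  have : g' x <= g' z by rewrite gz -ltnS ltn_ord.
  rewrite leq_eqVlt => /orP[/eqP/val_inj/perm_inj xz|/(inc _ _ dx)]; last by lia.
  by rewrite xz in ix; lia.
- move=> a b; case: (unliftP i a) => [x|] ->; last first.
    by rewrite ins_max_id /=; lia.
  case: (unliftP i b) => [y|] ->.
    by rewrite !ins_max_lift lift_lt; apply: dec.
  by rewrite ins_max_lift ins_max_id /=; have := ltn_ord (g x); lia.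
Qed.

End InsMax.

Lemma ins_max_inj m (i i' : 'I_m.+1) (g g' : 'S_m) :
  ins_max i g = ins_max i' g' -> i = i' /\ g = g'.
Proof.
move=> E; have ii : i = i'.
  by apply: (@perm_inj _ (ins_max i g)); rewrite {2}E !ins_max_id.
split=> //; apply/permP=> y; apply/val_inj => /=.
by rewrite -(ins_max_lift i) E ii ins_max_lift.
Qed.

(** * Exchanging the letters d and d+1, as in case B *)

Lemma tpermE_nat n (a b x : 'I_n) :
  [\/ x = a :> nat /\ tperm a b x = b :> nat,
      x = b :> nat /\ tperm a b x = a :> nat |
      [/\ x <> a :> nat, x <> b :> nat & tperm a b x = x :> nat]].
Proof.
case: tpermP => [->|->|xa xb]; [exact: Or31 | exact: Or32 | apply: Or33].
by split=> // /val_inj.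
Qed.

Lemma perm_eq_nat n (s : 'S_n) (i j : 'I_n) : s i = s j :> nat -> i = j :> nat.
Proof. by move=> /val_inj/perm_inj->. Qed.

Section SwapLetters.
Variables (n d : nat) (s : 'S_n) (a b : 'I_n).
Hypotheses (ad : a.+1 = d) (bd : b = d :> nat).

Let t := lmulp (tperm a b) s.

Let tE i :
  [\/ (s i).+1 = d /\ t i = d :> nat,
      s i = d :> nat /\ (t i).+1 = d |
      [/\ (s i).+1 <> d, s i <> d :> nat & t i = s i :> nat]].
Proof.
rewrite /t /lmulp permM; case: (tpermE_nat a b (s i))
  => [[-> ->]|[-> ->]|[sa sb ->]].
- by apply: Or31.
- by apply: Or32.
- by apply: Or33; split=> //; [rewrite -ad => -[] | rewrite -bd].
Qed.

Hypothesis sd : inv_ldes s d.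

(** In [s] these positions carry d+1 and d+2, and there the letters above d are in order. *)
Lemma swap_pred_before_succ (x z : 'I_n) : (t x).+1 = d -> t z = d.+1 :> nat -> x < z.
Proof.
have [inc _ _] := sd.
by move=> tx tz; apply: inc; case: (tE x) (tE z) => [[? ?]|[? ?]|[? ? ?]] [[? ?]|[? ?]|[? ? ?]]; lia.
Qed.

(** As d+1 precedes d in [s], the exchange removes that inversion and creates none. *)
Lemma swap_inversion (i j : 'I_n) : i < j -> t j < t i -> s j < s i.
Proof.
have [_ dec _] := sd; have := dec i j; have := dec j i.
by case: (tE i) (tE j) => [[? ?]|[? ?]|[? ? ?]] [[? ?]|[? ?]|[? ? ?]]; lia.
Qed.

Hypothesis av : s \in S321 n.

Lemma swap_S321 : t \in S321 n.
Proof.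
apply/S321P=> i j l ij jl lj ji; move/S321P: av; apply; [exact: ij | exact: jl | |];
  exact: swap_inversion.
Qed.

Hypothesis nmax : exists i j : 'I_n, i < j /\ (s i).+1 = n.

(* If the letter d preceded d+2, everything after d would be increasing
   and above d, so n would be the last letter. *)
Lemma succ_before_pred (x z : 'I_n) : (s x).+1 = d -> s z = d.+1 :> nat -> z < x.
Proof.
move=> sx sz; have [inc dec _] := sd; have [i [j [ij si]]] := nmax.
have sy : s ((s^-1)%g b) = d :> nat by rewrite permKV bd.
move: ((s^-1)%g b) sy => y sy; have yx := dec _ _ sx sy.
rewrite ltnNge; apply/negP; rewrite leq_eqVlt => /orP[/eqP/val_inj xz|xz].
  by rewrite xz in sx; lia.
have zi : z <= i.
  have [/perm_eq_nat|] := eqVneq (s z : nat) (s i); first by lia.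
  by move=> ne; apply/ltnW/inc; have := ltn_ord (s z); lia.
(* No letter above d can follow n, which is at [i]; so the letter at [j] is below d and completes a
   321 with d+1 at [y] and d at [x]. *)
have jx : s j < s x.
  have := @perm_eq_nat _ s j x; have := @perm_eq_nat _ s j i.
  have := ltn_ord (s j); have := @perm_eq_nat _ s j y.
  have := inc j i; lia.
by move/S321P: av => /(_ y x j); apply; lia.
Qed.

Hypothesis dn : d.+1 < n.

(** Now d+1 stands where d stood, behind d+2 by [succ_before_pred]; the letters from d+2 on have not
    moved. *)
Lemma swap_inv_ldes : inv_ldes t d.+1.
Proof.
have [inc dec _] := sd; split; last by right.
  move=> i j; have := inc i j.
  by case: (tE i) (tE j) => [[? ?]|[? ?]|[? ? ?]] [[? ?]|[? ?]|[? ? ?]]; lia.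
move=> i j ti tj; apply: succ_before_pred.
  by case: (tE i) => [[? ?]|[? ?]|[? ? ?]]; lia.
by case: (tE j) => [[? ?]|[? ?]|[? ? ?]]; lia.
Qed.

(** Only the position of d in [s] could become a maximum, its letter rising to d+1, but d+2 stands
    in front of it. None is lost, as no inversion is created. *)
Lemma swap_Ltr : Ltr t = Ltr s.
Proof.
apply/setP=> i; apply/LtrP/LtrP=> lr j ji; rewrite ltnNge leq_eqVlt; apply/negP.
  move=> /orP[/eqP/perm_eq_nat|sij]; first by lia.
  have := lr j ji; have szE : s ((s^-1)%g (Ordinal dn)) = d.+1 :> nat by rewrite permKV.
  move: ((s^-1)%g _) szE => z sz.
  have := @succ_before_pred i z; have := lr z.
  by case: (tE i) (tE j) (tE z)
    => [[? ?]|[? ?]|[? ? ?]] [[? ?]|[? ?]|[? ? ?]] [[? ?]|[? ?]|[? ? ?]]; lia.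
move=> /orP[/eqP/perm_eq_nat|]; first by lia.
by move=> /(swap_inversion ji); have := lr j ji; lia.
Qed.
End SwapLetters.

(** * Taking the largest letter away from the end, as in case C *)

Lemma Ltr_setD1_max m (s t : 'S_m.+1) :
    s ord_max = ord_max -> t ord_max <> ord_max ->
    (forall i j : 'I_m.+1, i < m -> j < m -> (t i < t j) = (s i < s j)) ->
  Ltr t = Ltr s :\ ord_max.
Proof.
move=> sm tm st; apply/setP=> i; rewrite in_setD1.
have [->|im] /= := eqVneq i ord_max.
  (* A left-to-right maximum in last position would be the largest letter. *)
  apply/negP => /LtrP lr; case: tm; apply/val_inj => /=.
  have tyE : t ((t^-1)%g ord_max) = m :> nat by rewrite permKV.
  move: ((t^-1)%g _) tyE => y ty; have := lr y; have := ltn_ord y.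
  have := ltn_ord (t ord_max); have [yE|] := eqVneq y ord_max; first by rewrite -yE.
  by rewrite -val_eqE /=; lia.
apply/LtrP/LtrP=> lr j ji; [rewrite -st | rewrite st]; try exact: lr;
  move: im; rewrite -val_eqE /=; have := ltn_ord i; lia.
Qed.

Section CycleLetters.
Variables (m d : nat) (s : 'S_m.+1).
Hypotheses (dm : d < m) (smax : s ord_max = ord_max).

(** The last letter becomes d+1 and the other letters from d+1 on rise by one, so the relative order
    changes only at the last position. *)
Let t := lmulp (up_cycle m d.+1) s.

Let t_max : t ord_max = d :> nat.
Proof.
rewrite /t /lmulp permM smax; apply: succn_inj.
by rewrite up_cycleE /= ?eqxx; last lia; case: ifP => //; lia.
Qed.

Let tE (i : 'I_m.+1) : i < m -> t i = s i + (d <= s i) :> nat.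
Proof.
move=> im; rewrite /t /lmulp permM; apply: succn_inj.
rewrite up_cycleE; last by lia.
have : s i <> m :> nat by move=> E; have := @perm_eq_nat _ s i ord_max; rewrite smax /=; lia.
by case: ifP; [|case: ifP]; lia.
Qed.

Lemma cycle_Ltr : Ltr t = Ltr s :\ ord_max.
Proof.
apply: Ltr_setD1_max => // [/(congr1 val)|i j im jm]; first by rewrite /= t_max; lia.
by rewrite !tE; lia.
Qed.

Hypothesis sd : inv_ldes s d.

(** In [s] these positions carry d and d+1, and there d+1 comes first. The order is opposite to that
    in [swap_pred_before_succ], which separates cases B and C. *)
Lemma cycle_succ_before_pred (x z : 'I_m.+1) :
  (t x).+1 = d -> t z = d.+1 :> nat -> z < x.
Proof.
have [_ dec _] := sd; move=> tx tz; have := dec x z.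
have := @tE x; have := @tE z; have := ltn_ord x; have := ltn_ord z.
have [xE|] := eqVneq x ord_max; first by rewrite xE t_max in tx; lia.
have [zE|] := eqVneq z ord_max; first by rewrite zE t_max in tz; lia.
by rewrite -!val_eqE /=; lia.
Qed.

(** The letters from d+2 on are the raised ones, still in order, and d+1 is last. *)
Lemma cycle_inv_ldes : inv_ldes t d.+1.
Proof.
have [inc _ _] := sd; split; last by right.
- move=> i j; have := inc i j; have := ltn_ord i; have := ltn_ord j.
  have := @tE i; have := @tE j.
  have [->|] := eqVneq i ord_max; first by rewrite t_max; lia.
  have [->|] := eqVneq j ord_max; first by rewrite t_max; lia.
  by rewrite -!val_eqE /=; lia.
- move=> i j; have := ltn_ord i; have := ltn_ord j.
  have [->|] := eqVneq j ord_max; first by rewrite t_max; lia.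
  have := @tE i; have [->|] := eqVneq i ord_max; first by rewrite -val_eqE /=; lia.
  by rewrite -!val_eqE /=; lia.
Qed.

Hypothesis av : s \in S321 m.+1.

(** A 321 ending at the last position would need a decreasing pair of raised letters, but those
    increase; any other 321 is already in [s]. *)
Lemma cycle_S321 : t \in S321 m.+1.
Proof.
have [inc _ _] := sd; apply/S321P=> i j l ij jl.
have := ltn_ord l => lm; rewrite (@tE j) ?(@tE i); try lia.
have [lE|] := eqVneq l ord_max.
  by rewrite lE t_max; have := inc j i; lia.
rewrite -val_eqE /= => ln; rewrite tE; last by lia.
by move/S321P: av => /(_ i j l ij jl); lia.
Qed.
End CycleLetters.

(** * The block number and its behaviour under deletion *)

Definition closed_prefix n (p : 'S_n) (j : nat) : bool :=
  [forall i : 'I_n, (i <= j) ==> (p i <= j)].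

Lemma blE m (p : 'S_m.+1) : bl p = (\sum_(j < m) closed_prefix p j).+1.
Proof.
rewrite /bl -sum1dep_card big_mkcond big_ord_recr /= ifT ?addn1; last first.
  by apply/forallP=> i; apply/implyP=> _; rewrite -ltnS ltn_ord.
by congr _.+1; apply: eq_bigr => j _; rewrite /closed_prefix; case: ifP.
Qed.

Lemma bl_leq n (p : 'S_n) : bl p <= n.
Proof. by rewrite /bl -[leqRHS]card_ord max_card. Qed.

Lemma bl_ins_max_last m (q : 'S_m) : bl (ins_max ord_max q) = (bl q).+1.
Proof.
rewrite blE; congr _.+1; rewrite /bl -sum1dep_card [RHS]big_mkcond.
apply: eq_bigr => j _; rewrite (_ : closed_prefix _ j = [forall i : 'I_m, (i <= j) ==> (q i <= j)]).
  by case: ifP.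
apply/forallP/forallP => H i.
  by have := H (lift ord_max i); rewrite ins_max_lift lift_max.
case: (unliftP ord_max i) => [y|] ->; first by rewrite ins_max_lift lift_max.
by apply/implyP => /=; have := ltn_ord j; lia.
Qed.

(** For cases B and C. Prefixes ending before [z] agree in both words, proper prefixes reaching [z]
    contain a letter too large to be closed, and the extra prefix of [p], all but its last letter,
    contains n. *)
Lemma bl_last_block m (p : 'S_m.+2) (q : 'S_m.+1) (y : 'I_m.+2) (z : 'I_m.+1) :
    p ord_max <> ord_max -> q z = m :> nat -> y <= z -> m <= p y ->
    (forall (x : 'I_m.+1) (x' : 'I_m.+2), x = x' :> nat -> x < z -> p x' = q x :> nat) ->
  bl p = bl q.
Proof.
move=> pm qz yz my pq; rewrite !blE big_ord_recr /=.
have -> : closed_prefix p m = false.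
  apply/negP => /forallP/(_ (p^-1%g ord_max)); rewrite permKV /=.
  rewrite ltnn implybF -ltnNge => lt; apply: pm.
  have E : (p^-1)%g ord_max = ord_max.
    by apply/val_inj => /=; have := ltn_ord ((p^-1)%g ord_max); lia.
  by have := permKV p ord_max; rewrite E.
rewrite addn0; congr _.+1; apply: eq_bigr => j _; congr nat_of_bool.
have jm := ltn_ord j; have [jz|zj] := ltnP j z; last first.
  transitivity false; [|symmetry]; apply/negP => /forallP.
    by move=> /(_ y)/implyP; lia.
  by move=> /(_ z)/implyP; lia.
apply/forallP/forallP => H x; apply/implyP => xj.
  have xm : x < m.+2 by lia.
  by rewrite -(pq x (Ordinal xm)) //; [apply: (implyP (H _)) | lia].
have xm : x < m.+1 by lia.
by rewrite (pq (Ordinal xm) x) //=; [apply: (implyP (H _)) | lia].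
Qed.

(** * The cases of the recursion *)

Lemma letter_max m : letter m m.+1 = ord_max.
Proof. by apply/val_inj; rewrite /= inordK. Qed.

(** Each case rebuilds [p] from a shorter word [q], on which the inductions run. In case C, [q]
    comes from the word with n-1 and n exchanged. *)
Variant f_spec m (p s : 'S_m.+2) : Prop :=
| FCaseA q of q \in S321 m.+1 & p = ins_max ord_max q & bl p = (bl q).+1
    & s = ins_max ord_max (f q)
| FCaseB i q of q \in S321 m.+1 & i != ord_max
    & p = ins_max i q & bl p = bl q
    & (forall y : 'I_m.+1, i <= y -> y \notin Ltr q)
    & s = lmulp (tperm (letter _ (m.+2 - bl p - 1)) (letter _ (m.+2 - bl p)))
                (ins_max i (f q))
| FCaseC q of q \in S321 m.+1 & bl p = bl q
    & p = lmulp (tperm (letter _ m.+1) (letter _ m.+2)) (ins_max ord_max q)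
    & Ltr p = Ltr (ins_max ord_max q) :\ ord_max
    & s = lmulp (up_cycle _ (m.+2 - bl p)) (ins_max ord_max (f q)).

Lemma ins_max_del_max m (p : 'S_m.+1) i : pos_max p = i -> p = ins_max i (del_max p).
Proof. by move=> <-; rewrite del_maxK. Qed.

Lemma fP m (p : 'S_m.+2) : p \in S321 m.+2 -> f_spec p (f p).
Proof.
move=> av; rewrite /= letter_max.
have del_av : del_max p \in S321 m.+1.
  by apply: (@S321_ins_max _ (pos_max p)); rewrite del_maxK.
case: eqP => [pmax|pmax].
  have pE := ins_max_del_max pmax; apply: (FCaseA del_av pE _ erefl).
  by rewrite {1}pE bl_ins_max_last.
have im : pos_max p != ord_max by apply/eqP.
have pnmax : p ord_max <> ord_max by move=> E; apply: pmax; rewrite -E permK.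
set w := letter m.+1 m.+1; have wE : w = m :> nat by rewrite /w /letter inordK //=; lia.
have pw : p ((p^-1)%g w) = m :> nat by rewrite permKV.
have pi : p (pos_max p) = ord_max by rewrite permKV.
case: ifP => lt.
  have pE := esym (del_maxK p).
  case: (unliftP (pos_max p) ((p^-1)%g w)) => /= [z zE|zE]; last first.
    by rewrite zE ltnn in lt.
  have qz : del_max p z = m :> nat.
    by rewrite -(ins_max_lift (pos_max p)) del_maxK -zE.
  have zi : z < pos_max p by rewrite -lift_lt_id -zE.
  apply: (FCaseB del_av im pE) => //.
    apply: (@bl_last_block _ _ _ (lift (pos_max p) z) z) => //.
    - by rewrite /= /bump; lia.
    - by rewrite -zE pw.
    - move=> x x' xx' xz; rewrite -(ins_max_lift (pos_max p)) del_maxK.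
      by congr (nat_of_ord (p _)); apply/val_inj; rewrite /= /bump leqNgt (ltn_trans xz zi).
  (* The largest letter of the shorter word, at [z], precedes the insertion point. *)
  move=> y iy; apply/negP => /LtrP/(_ z); have := ltn_ord (del_max p y); lia.
(* Otherwise n, n-1 and the last letter would form a 321. *)
have wlast : p ord_max = w.
  apply/val_inj; move: ((p^-1)%g w) pw lt => x px lt; rewrite /= wE.
  have ltn_max (y : 'I_m.+2) : y != ord_max -> y < m.+1.
    by rewrite -val_eqE /=; have := ltn_ord y; lia.
  have [<-//|/ltn_max xm] := eqVneq x ord_max.
  have ix : pos_max p < x.
    rewrite ltn_neqAle leqNgt lt andbT; apply/eqP => /val_inj E.
    by move: px; rewrite -E pi /=; lia.
  have := @perm_eq_nat _ p x ord_max; have := @perm_eq_nat _ p (pos_max p) ord_max.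
  have := ltn_ord (p ord_max); move/S321P: av => /(_ (pos_max p) x ord_max ix xm).
  by rewrite pi px /=; lia.
set p2 := lmulp _ p.
have p2max : p2 ord_max = ord_max by rewrite /p2 /lmulp permM wlast tpermL.
have p2pos : p2 (pos_max p) = w by rewrite /p2 /lmulp permM pi tpermR.
have p2E (i : 'I_m.+2) : i != ord_max -> i != pos_max p -> p2 i = p i.
  move=> im' ip; rewrite /p2 /lmulp permM tpermD //.
    by rewrite -wlast (inj_eq perm_inj) eq_sym.
  by rewrite -pi (inj_eq perm_inj) eq_sym.
(* Before the last position the exchange only turns n into n-1, which stays above the others. *)
have p2lt (i j : 'I_m.+2) : i < m.+1 -> j < m.+1 -> (p i < p j) = (p2 i < p2 j).
  have vals (k : 'I_m.+2) : k < m.+1 -> p k = m.+1 :> nat /\ p2 k = m :> nat \/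
      p k < m /\ p2 k = p k :> nat.
    move=> km; have [->|kp] := eqVneq k (pos_max p); first by rewrite pi p2pos wE; left.
    have kn : k != ord_max by rewrite -val_eqE /=; lia.
    right; rewrite p2E //; split=> //.
    have := @perm_eq_nat _ p k ord_max; rewrite wlast wE /=.
    have := ltn_ord (p k); have := @perm_eq_nat _ p k (pos_max p); rewrite pi /=.
    by move: kp; rewrite -val_eqE /=; lia.
  by move=> /vals ? /vals ?; lia.
have p2del : p2 = ins_max ord_max (del_max p2).
  by apply: ins_max_del_max; rewrite /pos_max -p2max permK.
have p2av : p2 \in S321 m.+2.
  apply/S321P=> i j l ij jl; have := ltn_ord l.
  rewrite ltnS leq_eqVlt => /orP[/eqP lE|lm].
    have -> : l = ord_max by apply/val_inj.
    by rewrite p2max /=; have := ltn_ord (p2 j); lia.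
  rewrite -!p2lt; try lia.
  by move=> lj ji; move/S321P: av => /(_ i j l); apply.
have qE (x : 'I_m.+1) : del_max p2 x = p2 (lift ord_max x) :> nat.
  by rewrite [in RHS]p2del ins_max_lift.
have zm : pos_max p < m.+1.
  by move: im; rewrite -val_eqE /=; have := ltn_ord (pos_max p); lia.
have zE : lift ord_max (Ordinal zm) = pos_max p by apply/val_inj; exact: lift_max.
apply: (@FCaseC _ _ _ (del_max p2)) => //.
- by apply: (@S321_ins_max _ ord_max); rewrite -p2del.
- apply: (@bl_last_block _ _ _ (pos_max p) (Ordinal zm)) => //.
  + by rewrite qE zE p2pos.
  + by rewrite pi /=; lia.
  + move=> x x' xx' xz; rewrite qE; congr nat_of_ord.
    have -> : lift ord_max x = x' by apply/val_inj; exact: etrans (lift_max _) xx'.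
    by rewrite p2E // -val_eqE /=; move: xz => /=; lia.
- by rewrite letter_max -p2del /p2 /lmulp -mulgA tperm2 mulg1.
- by rewrite -p2del; apply: Ltr_setD1_max.
Qed.

(** * Avoidance, descents and maxima of the image *)

Section Step.
Variables (m : nat) (q g : 'S_m.+1).
Hypotheses (g_av : g \in S321 m.+1) (g_ldes : inv_ldes g (m.+1 - bl q)).
Hypothesis g_Ltr : Ltr g = Ltr q.

(** In cases B and C [bl q] is k and [q] has size n-1, so d is n-k-1, one less than the image
    requires. *)
Let d := m.+1 - bl q.

Lemma caseB_hyps (i : 'I_m.+2) :
    i != ord_max -> (forall y : 'I_m.+1, i <= y -> y \notin Ltr q) ->
    let s := ins_max i g in
  [/\ (letter m.+1 (m.+2 - bl q - 1)).+1 = d /\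
      letter m.+1 (m.+2 - bl q) = d :> nat,
      d.+1 < m.+2, s \in S321 m.+2, inv_ldes s d
    & exists x y : 'I_m.+2, x < y /\ (s x).+1 = m.+2].
Proof.
move=> im; rewrite -g_Ltr => nL s; have s_ldes := ins_max_inv_ldes nL g_ldes.
have bq : 0 < bl q by rewrite blE.
have bm := bl_leq q.
have im' : i < m.+1 by move: im; rewrite -val_eqE /=; have := ltn_ord i; lia.
(* If d were 0, all of [s] would increase and n would be last. So there is a letter d to
   exchange. *)
have d0 : 0 < d.
  rewrite lt0n; apply/eqP => dE; have [inc _ _] := s_ldes.
  have := inc ord_max i; rewrite -/d dE /= ins_max_id /=.
  have := @perm_eq_nat _ s i ord_max; rewrite /s ins_max_id /=.
  by have := ltn_ord (ins_max i g ord_max); lia.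
split=> //.
- by rewrite /letter !inordK /d; lia.
- by rewrite /d; lia.
- exact: ins_max_S321.
- by exists i, ord_max; rewrite /s ins_max_id.
Qed.

Lemma caseC_hyps (s := ins_max ord_max g) :
  [/\ m.+2 - bl q = d.+1, d < m.+1, s \in S321 m.+2, inv_ldes s d
    & s ord_max = ord_max].
Proof.
have nL (y : 'I_m.+1) : @ord_max m.+1 <= y -> y \notin Ltr g.
  by have := ltn_ord y; rewrite /=; lia.
have bq : 0 < bl q by rewrite blE.
have bm := bl_leq q.
split; [by rewrite /d; lia | by rewrite /d; lia | exact: ins_max_S321
       | exact: ins_max_inv_ldes | exact: ins_max_id].
Qed.
End Step.

Lemma f_inv n (p : 'S_n) : p \in S321 n ->
  [/\ f p \in S321 n, inv_ldes (f p) (n - bl p) & Ltr (f p) = Ltr p].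
Proof.
elim: n p => [|[|m] IH] p av.
- by split=> //; split; [case | case | left].
- split=> //; split; [by move=> i j; rewrite !ord1 ltnn | | by rewrite blE; lia].
  by move=> i j; rewrite !ord1 => <- /eqP; rewrite -subn_eq0; lia.
case: (fP av) => [q /IH[gav gl gL] pE pbl ->
  |i q /IH[gav gl gL] im pE pbl nL ->|q /IH[gav gl gL] pbl _ pL ->].
- have [_ _ sav sl _] := caseC_hyps gav gl.
  by rewrite pbl subSS; split=> //; rewrite pE; apply: eq_Ltr_ins_max.
- have [[aE bE] dm sav sl sm] := caseB_hyps gav gl gL im nL.
  rewrite pbl; split; [exact: (swap_S321 aE bE sl sav) | | ].
    by have := swap_inv_ldes aE bE sl sav sm dm; rewrite -subSn ?bl_leq.
  by rewrite (swap_Ltr aE bE sl sav sm dm) pE; apply: eq_Ltr_ins_max.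
- have [dE dm sav sl sm] := caseC_hyps gav gl.
  rewrite pbl dE; split; [exact: cycle_S321 | exact: cycle_inv_ldes | ].
  by rewrite cycle_Ltr // pL; congr (_ :\ _); apply: eq_Ltr_ins_max.
Qed.

Lemma ldes_f n (p : 'S_n) : p \in S321 n -> ldes (f p)^-1%g = n - bl p.
Proof. by case/f_inv => _ /inv_ldesE. Qed.

(** * Injectivity and the bijection *)

Lemma f_cases_disjoint m (i : 'I_m.+2) (q q' : 'S_m.+1) :
    q \in S321 m.+1 -> q' \in S321 m.+1 -> i != ord_max ->
    bl q = bl q' -> (forall y : 'I_m.+1, i <= y -> y \notin Ltr q) ->
  lmulp (tperm (letter _ (m.+2 - bl q - 1)) (letter _ (m.+2 - bl q))) (ins_max i (f q))
    <> lmulp (up_cycle _ (m.+2 - bl q)) (ins_max ord_max (f q')).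
Proof.
move=> /f_inv[gav gl gL] /f_inv[gav' gl' _] im bE nL E.
have [[aE lE] dm sav sl sm] := caseB_hyps gav gl gL im nL.
have [dE' dm' sav' sl' sm'] := caseC_hyps gav' gl'.
rewrite [in RHS]bE dE' -bE in E.
have B := swap_pred_before_succ aE lE sl; rewrite -bE in dm' sl'.
have C := cycle_succ_before_pred dm' sm' sl'; rewrite -E in C.
(* [a] is the letter d, positive by case B, and [Ordinal dm] is d+2; [B] and [C] order their
   positions oppositely. *)
set t := lmulp _ _ in B C; set a := letter _ _ in aE.
have ta : (t ((t^-1)%g a)).+1 = m.+1 - bl q by rewrite permKV.
have tc : t ((t^-1)%g (Ordinal dm)) = (m.+1 - bl q).+1 :> nat by rewrite permKV.
by have := B _ _ ta tc; have := C _ _ ta tc; lia.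
Qed.

Lemma f_inj n : {in S321 n &, injective (@f n)}.
Proof.
elim: n => [|[|m] IH] p p' av av' E //.
have bE : bl p = bl p'.
  by have := ldes_f av; rewrite E ldes_f //; have := bl_leq p; have := bl_leq p'; lia.
have lE : Ltr p = Ltr p'.
  by have [_ _ <-] := f_inv av; rewrite E; have [_ _ ->] := f_inv av'.
(* The last position is a left-to-right maximum in case A only, so equal [Ltr] rules out mixing A
   with B or C. *)
have LtrA (r : 'S_m.+1) : ord_max \in Ltr (ins_max ord_max r) by apply: Ltr_ins_max_id.
have LtrB (i : 'I_m.+2) (r : 'S_m.+1) : i != ord_max -> ord_max \notin Ltr (ins_max i r).
  case: (unliftP i ord_max) => /= [y yE _|->]; last by rewrite eqxx.
  rewrite yE Ltr_ins_max_lift negb_and -leqNgt; apply/orP; left.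
  rewrite -id_lt_lift -yE /=; have := neq_lift i y.
  by rewrite -yE -val_eqE /=; have := ltn_ord i; lia.
case: (fP av) (fP av') => [q qS pE pbl sE|i q qS im pE pbl nL sE|q qS pbl pE pL sE]
  [q' qS' pE' pbl' sE'|i' q' qS' im' pE' pbl' nL' sE'|q' qS' pbl' pE' pL' sE'];
  rewrite E sE' in sE.
- by have [_ /IH qq] := ins_max_inj sE; rewrite pE pE' qq.
- by have := LtrB i' q' im'; rewrite -pE' -lE pE LtrA.
- by have := LtrA q; rewrite -pE lE pL' in_setD1 eqxx.
- by have := LtrB i q im; rewrite -pE lE pE' LtrA.
- by move: sE; rewrite bE => /mulIg/ins_max_inj[ii /IH qq]; rewrite pE pE' ii qq.
- case: (@f_cases_disjoint m i q q') => //; first by rewrite -pbl -pbl'.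
  by rewrite -pbl -sE -bE.
- by have := LtrA q'; rewrite -pE' -lE pL in_setD1 eqxx.
- case: (@f_cases_disjoint m i' q' q) => //; first by rewrite -pbl -pbl'.
  by rewrite -pbl' sE bE.
- by move: sE; rewrite bE => /mulIg/ins_max_inj[_ /IH qq]; rewrite pE pE' qq.
Qed.

Theorem theorem4p5 (n k : nat) (hk : 1 <= k <= n) :
  [/\ {in Bl n k &, injective (@f n)},
      [set @f n p | p in Bl n k] = L n (n - k)
    & {in Bl n k, forall p : 'S_n, Ltr (@f n p) = Ltr p}].
Proof.
have BlP p : p \in Bl n k -> p \in S321 n /\ bl p = k by rewrite inE => /andP[? /eqP].
split.
- by move=> p p' /BlP[av _] /BlP[av' _]; apply: f_inj.
- apply/setP=> s; apply/imsetP/idP => [[p /BlP[av pk] ->]|].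
    by rewrite inE ldes_f // pk eqxx andbT; have [] := f_inv av.
  rewrite inE => /andP[sav /eqP sk].
  have fS : [set f p | p in S321 n] = S321 n.
    apply/eqP; rewrite eqEcard card_in_imset ?leqnn ?andbT; last exact: f_inj.
    by apply/subsetP=> _ /imsetP[p av ->]; have [] := f_inv av.
  move: sav sk; rewrite -{1}fS => /imsetP[p av ->]; rewrite ldes_f // => pk.
  exists p => //; rewrite inE av /=; apply/eqP.
  (* Subtraction is truncated: [bl p = k] follows since both are at most n. *)
  by have := bl_leq p; move: hk pk; lia.
- by move=> p /BlP[av _]; have [] := f_inv av.
Qed.
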